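(* Let $q$ be a prime power. Suppose that $m\not\equiv3,5\pmod 6$ and $m\ge4$. Then there exists a (nondegenerate) minimal $[m+2,3]_{q^m/q}$ code.
   Context: Let $q$ be a prime power and $n,m,k$ positive integers. For $v\in\mathbb{F}_{q^m}^n$ and an ordered basis $\Gamma=(\gamma_1,\dots,\gamma_m)$ of $\mathbb{F}_{q^m}$ over $\mathbb{F}_q$, let $\Gamma(v)\in\mathbb{F}_q^{n\times m}$ be the matrix with $v_i=\sum_{j}\Gamma(v)_{ij}\gamma_j$. The rank support $\sigma^{\mathrm{rk}}(v)\subseteq\mathbb{F}_q^n$ is the column space of $\Gamma(v)$ (independent of $\Gamma$). An $[n,k]_{q^m/q}$ code is a $k$-dimensional $\mathbb{F}_{q^m}$-subspace $\mathcal{C}\subseteq\mathbb{F}_{q^m}^n$; it is nondegenerate if $\sum_{v\in\mathcal{C}}\sigma^{\mathrm{rk}}(v)=\mathbb{F}_q^n$, and minimal if for all $v,v'\in\mathcal{C}$, $\sigma^{\mathrm{rk}}(v')\subseteq\sigma^{\mathrm{rk}}(v)$ implies $v'=\alpha v$ for some $\alpha\in\mathbb{F}_{q^m}$. *)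

(* Defs.v *)
From HB Require Import structures.
From mathcomp Require Import all_boot all_order all_algebra all_field.

Set Implicit Arguments.
Unset Strict Implicit.
Unset Printing Implicit Defensive.

Import GRing.Theory.
Local Open Scope ring_scope.

(* Throughout, F plays the role of F_q and L that of F_(q^m), m = \dim {:L};  *)
(* up to isomorphism every such pair is of this form, and conversely.         *)
Section RankMetric.

Variables (F : finFieldType) (L : fieldExtType F) (n : nat).

Definition expand_mx (m : nat) (G : m.-tuple L) (v : 'rV[L]_n) : 'M[F]_(n, m) :=
  \matrix_(i < n, j < m) coord G j (v 0 i).

Definition col_space (m : nat) (A : 'M[F]_(n, m)) : {vspace 'cV[F]_n} :=
  <<[seq col j A | j <- enum 'I_m]>>%VS.

(* Computed in the library's basis of L; see rank_suppE for independence of   *)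
(* that choice.                                                               *)
Definition rank_supp (v : 'rV[L]_n) : {vspace 'cV[F]_n} :=
  col_space (expand_mx (vbasis {:L}) v).

(* finvect_type L is L with a finType structure, which makes the family of    *)
(* codewords a finite index set; 'rV[finvect_type L]_n is 'rV[L]_n.           *)
Definition nondegenerate_code (C : {vspace 'rV[L]_n}) : Prop :=
  (\sum_(v : 'rV[finvect_type L]_n | (v : 'rV[L]_n) \in C) rank_supp v)%VS
  = fullv.

Definition minimal_code (C : {vspace 'rV[L]_n}) : Prop :=
  forall v v' : 'rV[L]_n, v \in C -> v' \in C ->
    (rank_supp v' <= rank_supp v)%VS -> exists a : L, v' = a *: v.

Lemma expand_mxE m (G : m.-tuple L) (v : 'rV[L]_n) i :
  basis_of {:L} G -> v 0 i = \sum_(j < m) expand_mx G v i j *: G`_j.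
Proof.
move=> bG; rewrite {1}(coord_basis bG (memvf (v 0 i))).
by apply: eq_bigr => j _; rewrite mxE.
Qed.

Lemma col_space_expand_sub m m' (G : m.-tuple L) (G' : m'.-tuple L) (v : 'rV[L]_n) :
  basis_of {:L} G -> basis_of {:L} G' ->
  (col_space (expand_mx G v) <= col_space (expand_mx G' v))%VS.
Proof.
move=> bG bG'; apply/span_subvP => _ /mapP[j _ ->].
have -> : col j (expand_mx G v)
        = \sum_(k < m') coord G j G'`_k *: col k (expand_mx G' v).
  apply/colP => i; rewrite summxE !mxE {1}(expand_mxE v i bG') linear_sum /=.
  by apply: eq_bigr => k _; rewrite linearZ /= !mxE mulrC.
by apply: memv_suml => k _; apply/memvZ/memv_span/map_f; rewrite mem_enum.
Qed.

Lemma rank_suppE m (G : m.-tuple L) (v : 'rV[L]_n) :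
  basis_of {:L} G -> rank_supp v = col_space (expand_mx G v).
Proof.
move=> bG; apply/eqP; rewrite eqEsubv.
by rewrite !col_space_expand_sub // vbasisP.
Qed.

End RankMetric.

(* Main.v *)
(* An F-subspace U of L^3 is scattered if no L-line contains two F-independent
   vectors of U. If dim_F U = m + 2, every L-plane H meets U in F-dimension at
   least 2, hence U cap H spans H over L; taking a basis of U as the columns of a
   3 x (m + 2) generator matrix, the annihilator in F^(m+2) of the rank support
   of the codeword of a is U cap a^perp, so it determines a up to a scalar and
   the code is minimal.

   It remains to find a scattered U of dimension m + 2.

   m = 2d: let K be the subfield of degree d, L = K + K w, s the Frobenius of K
   over F, and U = {f(x) + x w : x in K^3} with f the s-semilinear companion map
   of the skew polynomial X^3 - X - c. If l in L \ F sent a point of U into U,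
   then f(f(x)) would be a K-combination of x and f(x) for some x <> 0, and the
   skew polynomial would have a linear factor on the left or on the right. Both
   are excluded when u^(1+q+q^2) - u = c has no solution u in K; such a c exists because
   u |-> u^(1+q+q^2) - u takes the same value at 0 and 1.

   m = 1 mod 6: the field M = L(theta), with theta of degree 3 over F, contains
   E = F(theta), linearly disjoint from L. A scattered E-subspace of M of
   E-dimension (m + 2)/3 is built greedily by counting the forbidden vectors. *)
From HB Require Import structures.
Require Import Defs.
From mathcomp Require Import all_boot all_order all_algebra all_field.
From mathcomp Require Import fingroup cyclic ring zify.

Set Implicit Arguments.
Unset Strict Implicit.
Unset Printing Implicit Defensive.

Import GRing.Theory.
Local Open Scope ring_scope.

(** * Codes from scattered subspaces *)

Local Notation "x ^L" := (map_mx (in_alg _) x) (at level 1, format "x ^L").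

(** * Rank supports and orthogonality *)

Section RankSupport.

Variables (F : finFieldType) (L : fieldExtType F) (n : nat).
Implicit Types (v : 'rV[L]_n) (x : 'rV[F]_n).

Lemma mulmx_expand v x j :
  (x *m expand_mx (vbasis {:L}) v) 0 j = coord (vbasis {:L}) j ((x^L *m v^T) 0 0).
Proof.
rewrite !mxE linear_sum; apply: eq_bigr => i _.
by rewrite !mxE /= mulr_algl linearZ.
Qed.

Lemma expand_orthP v x :
  reflect (x^L *m v^T = 0) (x *m expand_mx (vbasis {:L}) v == 0).
Proof.
apply: (iffP eqP) => xv0.
  apply/matrixP => i j; rewrite !ord1 [RHS]mxE.
  rewrite (coord_vbasis (memvf ((x^L *m v^T) 0 0))) big1 // => k _.
  by rewrite -mulmx_expand xv0 mxE scale0r.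
by apply/rowP => j; rewrite mulmx_expand xv0 !mxE linear0.
Qed.

(** The rank support is spanned by the coordinate columns of the entries of [v], so its annihilator
    consists of the [F]-linear relations between these entries. *)
Lemma rank_supp_orthP v x :
  x^L *m v^T = 0 <-> forall w, w \in rank_supp v -> x *m w = 0.
Proof.
split=> [/expand_orthP/eqP xv0 w | xS].
  suff /subvP sub_ker : (rank_supp v <= lker (linfun (mulmx x)))%VS.
    by move=> /sub_ker; rewrite memv_ker lfunE => /eqP.
  apply/span_subvP => _ /mapP[j _ ->].
  by rewrite memv_ker lfunE /= colE mulmxA xv0 mul0mx.
apply/expand_orthP/eqP/rowP => j; rewrite [RHS]mxE.
have /xS/matrixP/(_ 0 0) : col j (expand_mx (vbasis {:L}) v) \in rank_supp v.
  by apply: memv_span; apply/mapP; exists j; rewrite ?mem_enum.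
by rewrite colE mulmxA -colE !mxE.
Qed.

Lemma orth_vspaceP (S : {vspace 'cV[F]_n}) :
  (forall x, (forall w, w \in S -> x *m w = 0) -> x = 0) -> S = fullv.
Proof.
move=> S0; apply/eqP; rewrite eqEdim subvf dimvf /= /dim /= muln1 leqNgt.
apply/negP => ltSn.
pose B := \matrix_(i < n, j < \dim S) (vbasis S)`_j i 0.
have rB : (\rank B < n)%N by apply: leq_ltn_trans (rank_leq_col _) ltSn.
have : kermx B != 0.
  by rewrite -mxrank_eq0 mxrank_ker subn_eq0 -ltnNge.
case/rowV0Pn => x /sub_kermxP xB0 /eqP[]; apply: S0 => w /coord_vbasis->.
rewrite mulmx_sumr big1 // => j _; rewrite -scalemxAr.
suff -> : x *m (vbasis S)`_j = 0 by rewrite scaler0.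
apply/matrixP => a b; rewrite !ord1 [RHS]mxE.
move/rowP/(_ j): xB0; rewrite !mxE => xB0; rewrite -[RHS]xB0.
by apply: eq_bigr => i _; rewrite mxE.
Qed.

End RankSupport.

(** * From a scattered subspace to a minimal code *)

Section ScatteredCode.

Variables (F : finFieldType) (L : fieldExtType F) (n : nat).
Variable G : 'M[L]_(n, 3).
Hypothesis dim_lt : (\dim {:L}).+2 = n.
Hypothesis L_gt1 : (1 < \dim {:L})%N.
Hypothesis scatG : forall (l : L) (x y : 'rV[F]_n),
  l \notin 1%VS -> x^L *m G = l *: (y^L *m G) -> x = 0.

Let F_inj (x : 'rV[F]_n) : x^L *m G = 0 -> x = 0.
Proof.
have [l lF] : exists l : L, l \notin 1%VS.
  have : ~~ ({:L} <= 1)%VS.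
    by apply/negP => /dimvS; rewrite dimv1 leqNgt L_gt1.
  by case/subvPn => l _; exists l.
move=> xG; apply: (scatG (y := 0) lF).
by rewrite xG map_mx0 mul0mx scaler0.
Qed.

Lemma scattered_hyperplane (a b : 'rV[L]_3) : a != 0 ->
  (forall x : 'rV[F]_n, x^L *m G *m a^T = 0 -> x^L *m G *m b^T = 0) ->
  exists c, b = c *: a.
Proof.
move=> nz_a sub_ab.
pose A := expand_mx (vbasis {:L}) (a *m G^T).
have kerA (x : 'rV_n) : (x <= kermx A)%MS -> x^L *m G *m a^T = 0.
  move=> /sub_kermxP/eqP/expand_orthP.
  by rewrite trmx_mul trmxK mulmxA.
(* [A] has [\dim {:L}] = n - 2 columns, so its left kernel, the trace of the plane a^perp on U, has
   dimension at least 2. *)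
have rkA : (1 < \rank (kermx A))%N.
  rewrite mxrank_ker ltn_subRL addn1.
  by rewrite -[X in (_ < X)%N]dim_lt !ltnS rank_leq_col.
have [x xA nz_x] : exists2 x : 'rV[F]_n, (x <= kermx A)%MS & x != 0.
  by apply/rowV0Pn; rewrite -mxrank_eq0 -lt0n ltnW.
have : ~~ (kermx A <= x)%MS.
  by apply/negP => /mxrankS; rewrite rank_rV nz_x leqNgt rkA.
case/row_subPn => i; set y := row i _ => yx.
have yA : (y <= kermx A)%MS by apply: row_sub.
have nz_y : y != 0 by apply: contraNneq yx => ->; rewrite sub0mx.
pose N := col_mx (x^L *m G) (y^L *m G).
(* In an [L]-relation between the rows, a ratio [- s / r] outside [F] contradicts scatteredness, and
   one in [F] puts [y] on the line of [x]. *)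
have rkN : \rank N = 2.
  apply/eqP/inj_row_free => v; rewrite -[v]hsubmxK mul_row_col.
  rewrite [lsubmx v]mx11_scalar [rsubmx v]mx11_scalar !mul_scalar_mx.
  set r := lsubmx v 0 0; set s := rsubmx v 0 0 => rs0.
  have r0 : r = 0.
    apply/eqP/negPn/negP => nz_r.
    have gxy : x^L *m G = (- s / r) *: (y^L *m G).
      apply: (scalerI nz_r); rewrite scalerA mulrCA divff // mulr1 scaleNr.
      by apply/eqP; rewrite -addr_eq0 rs0.
    have [|/(@scatG _ _ _)] := boolP (- s / r \in 1%VS); last first.
      by move=> /(_ _ _ gxy)/eqP; rewrite (negPf nz_x).
    case/vlineP => c Dc; case/negP: yx.
    have Dx : x = c *: y.
      apply/eqP; rewrite -subr_eq0; apply/eqP/F_inj.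
      rewrite map_mxD map_mxN map_mxZ /= mulmxDl mulNmx -scalemxAl.
      by rewrite -in_algE in Dc; rewrite gxy Dc subrr.
    have nz_c : c != 0.
      by apply: contraNneq nz_x => c0; rewrite Dx c0 scale0r.
    by rewrite -[y](scalerK nz_c) -Dx scalemx_sub.
  move: rs0; rewrite r0 scale0r add0r => /eqP.
  rewrite scaler_eq0 => /orP[/eqP-> | /eqP/F_inj/eqP]; last by rewrite (negPf nz_y).
  by rewrite raddf0 row_mx0.
(* The linear forms vanishing on the plane spanned by the two points of U form a line, which
   contains both [a] and [b]. *)
have rkK : \rank (kermx N^T) = 1 by rewrite mxrank_ker mxrank_tr rkN.
have aK : (a <= kermx N^T)%MS.
  apply/sub_kermxP/trmx_inj; rewrite trmx_mul trmxK mul_col_mx.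
  by rewrite !kerA // col_mx0 trmx0.
have bK : (b <= kermx N^T)%MS.
  apply/sub_kermxP/trmx_inj; rewrite trmx_mul trmxK mul_col_mx.
  by rewrite !sub_ab ?kerA // col_mx0 trmx0.
apply/sub_rVP; apply: submx_trans bK _.
by have [_ <-] := mxrank_leqif_sup aK; rewrite rank_rV nz_a rkK.
Qed.

Definition row_code : {vspace 'rV[L]_n} := limg (linfun (mulmxr G^T)).

Lemma row_codeP v : reflect (exists a, v = a *m G^T) (v \in row_code).
Proof.
apply: (iffP memv_imgP) => [[a _ ->] | [a ->]]; exists a; rewrite ?lfunE ?memvf //.
Qed.

Lemma dim_row_code : \dim row_code = 3%N.
Proof.
have ker0 : lker (linfun (mulmxr G^T) : 'Hom('rV[L]_3, 'rV[L]_n)) == 0%VS.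
  apply/lker0P => a b; rewrite !lfunE /=.
  move/eqP; rewrite -subr_eq0 -mulmxBl => /eqP abG; apply/eqP; rewrite -subr_eq0.
  move: (a - b) abG => {b}a aG; apply/eqP/rowP => i; rewrite [RHS]mxE.
  (* A form [a] that vanishes on all of U is a multiple of every unit form by
     [scattered_hyperplane]; a unit form with [j != i] gives entry [i] equal to 0. *)
  have [j ij] : exists j : 'I_3, j != i.
    by have [->|] := eqVneq i 0; [exists 1 | exists 0; rewrite eq_sym].
  have [|x _|c ->] := @scattered_hyperplane (delta_mx 0 j) a.
  - apply: contra_neq (oner_neq0 L) => /rowP/(_ j).
    by rewrite !mxE !eqxx.
  - by apply: trmx_inj; rewrite trmx_mul trmxK trmx_mul mulmxA aG mul0mx trmx0.
  by rewrite !mxE eqxx eq_sym (negPf ij) mulr0.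
by rewrite limg_dim_eq ?(eqP ker0) ?capv0 // dimvf.
Qed.

Lemma minimal_row_code : minimal_code row_code.
Proof.
move=> _ v' /row_codeP[a ->] /row_codeP[b Dv'] sub_vv'.
have sub_orth (x : 'rV[F]_n) : x^L *m (a *m G^T)^T = 0 -> x^L *m v'^T = 0.
  move=> /rank_supp_orthP xv; apply/rank_supp_orthP => w ww'; apply: xv.
  exact: (subvP sub_vv').
have [a0 | nz_a] := eqVneq a 0.
  exists 1; rewrite a0 mul0mx scaler0; apply/rowP => i; rewrite mxE.
  have := sub_orth (delta_mx 0 i); rewrite a0 mul0mx trmx0 mulmx0 => /(_ erefl).
  move/matrixP/(_ 0 0); rewrite !mxE (bigD1 i) //= big1 => [|j ji].
    by rewrite !mxE !eqxx rmorph1 mul1r addr0.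
  by rewrite !mxE (negPf ji) andbF rmorph0 mul0r.
have [x|c Db] := @scattered_hyperplane a b nz_a.
  by have := sub_orth x; rewrite Dv' !trmx_mul !trmxK !mulmxA.
by exists c; rewrite Dv' Db scalemxAl.
Qed.

Lemma nondegenerate_row_code : nondegenerate_code row_code.
Proof.
apply: orth_vspaceP => x xS; apply: F_inj.
apply/rowP => j; rewrite [RHS]mxE.
(* The codewords of the three unit vectors suffice: orthogonality to their supports says that each
   coordinate of [x^L *m G] is 0. *)
have /rank_supp_orthP/matrixP/(_ 0 0) : forall w,
    w \in rank_supp (delta_mx 0 j *m G^T) -> x *m w = 0.
  move=> w ww; apply: xS; apply: subvP ww => /=.
  apply: (@sumv_sup _ _ _ (delta_mx 0 j *m G^T : 'rV[finvect_type L]_n)) => //.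
  by apply/row_codeP; exists (delta_mx 0 j).
by rewrite trmx_mul trmxK mulmxA trmx_delta -colE !mxE.
Qed.

End ScatteredCode.

(* A scattered subspace, given by a parametrisation g of it; y = 0 in the second
   clause shows that g is injective as soon as L <> F. *)
Definition scattered_map (F : finFieldType) (L : fieldExtType F) (V : lmodType L)
    (n : nat) (g : 'rV[F]_n -> V) : Prop :=
  (forall a x y, g (a *: x + y) = a%:A *: g x + g y) /\
  (forall l x y, l \notin 1%VS -> g x = l *: g y -> x = 0).

Lemma code_of_scattered_map (F : finFieldType) (L : fieldExtType F) (m n : nat)
    (g : 'rV[F]_n -> 'rV[L]_3) :
  \dim {:L} = m -> (1 < m)%N -> (m + 2 <= n)%N -> scattered_map g ->
  exists C : {vspace 'rV[L]_(m + 2)},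
    [/\ \dim C = 3%N, nondegenerate_code C & minimal_code C].
Proof.
move=> dimL m_gt1 le_mn [gL g_scat].
(* Padding by zeros restricts [g] to dimension exactly m + 2; a subspace of a scattered subspace is
   scattered. *)
pose J : 'M[F]_(m + 2, n) := pid_mx (m + 2).
pose G := \matrix_(i < m + 2) g (delta_mx 0 i *m J).
have g0 : g 0 = 0.
  have := gL (-1) 0 0; rewrite scaler0 addr0 scaleN1r scaleNr scale1r addNr.
  by [].
have gG x : x^L *m G = g (x *m J).
  have gsum (I : Type) (r : seq I) (a : I -> F) (f : I -> 'rV[F]_n) :
      g (\sum_(i <- r) a i *: f i) = \sum_(i <- r) (a i)%:A *: g (f i).
    by elim/big_rec2: _ => [|i y1 y2 _ <-]; rewrite ?g0 ?gL.
  rewrite mulmx_sum_row {2}(row_sum_delta x) mulmx_suml.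
  under [in RHS]eq_bigr do rewrite -scalemxAl.
  by rewrite gsum; apply: eq_bigr => i _; rewrite mxE rowK.
have scatG (l : L) (x y : 'rV[F]_(m + 2)) :
    l \notin 1%VS -> x^L *m G = l *: (y^L *m G) -> x = 0.
  rewrite !gG => lF /(g_scat _ _ _ lF)/(congr1 (mulmx^~ J^T)).
  by rewrite mul0mx -mulmxA tr_pid_mx pid_mx_id // pid_mx_1 mulmx1.
have dim_lt : (\dim {:L}).+2 = (m + 2)%N by rewrite dimL addn2.
have L_gt1 : (1 < \dim {:L})%N by rewrite dimL.
exists (row_code G); split.
- exact: (dim_row_code dim_lt L_gt1 scatG).
- exact: (nondegenerate_row_code L_gt1 scatG).
- exact: (minimal_row_code dim_lt L_gt1 scatG).
Qed.

(** * Even m *)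

(** Supplies the constants c: both u^(1+q+q^2) - u and u^3 - u agree at 0 and 1, so each misses a
    value. *)
Lemma not_inj_not_surj (T : finType) (f : T -> T) x y :
  x != y -> f x = f y -> exists c, forall u, f u != c.
Proof.
move=> xy fxy; have [/existsP[c /forallP cP]|] :=
  boolP [exists c, [forall u, f u != c]]; first by exists c.
rewrite negb_exists => /forallP f_surj; case/eqP: xy; move: fxy.
suff /injectiveP f_inj : injectiveb f by apply: f_inj.
rewrite /injectiveb /dinjectiveb; apply/card_uniqP.
rewrite -[RHS]/(size (image f T)) size_image; apply: eq_card => c.
have := f_surj c; rewrite negb_forall => /existsP[u /negPn/eqP <-].
by rewrite inE; apply: image_f.
Qed.

(** The computation behind [cyclic_vector], where [l] is l0 and [a] is the opposite of the
    coefficient there. Images under iterates of [s] are treated as independent unknowns, and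
    [c * sl / a / l] is the root l1 / l0. *)
Lemma norm_root_identity (K : fieldType) (c sc ssc l sl ssl sssl a sa ssa : K) :
  l != 0 -> sl != 0 -> ssl != 0 -> a != 0 -> sa != 0 -> ssa != 0 ->
  a * l = sc * (ssc * sssl / ssa) / sa - sl ->
  c * sl / a / l * (sc * ssl / sa / sl) * (ssc * sssl / ssa / ssl)
    - c * sl / a / l = c.
Proof.
move=> nz_l nz_sl nz_ssl nz_a nz_sa nz_ssa al.
have D : sc * ssc * sssl = (a * l + sl) * sa * ssa.
  by rewrite al; field; rewrite nz_sa nz_ssa.
transitivity (c / (a * l) * (sc * ssc * sssl / (sa * ssa) - sl)).
  by field; rewrite nz_l nz_sl nz_ssl nz_a nz_sa nz_ssa.
by rewrite D; field; rewrite nz_l nz_sa nz_ssa nz_a.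
Qed.

(** * The companion map of the skew polynomial X^3 - X - c *)

Section SkewCubic.

Variables (K : finFieldType) (s : {rmorphism K -> K}) (d : nat).
Hypothesis s_order : forall x, iter d s x = x.

Let Tr x := \sum_(i < d) iter i s x.
Hypothesis Tr_neq0 : exists t, Tr t != 0.

Variable c : K.
Hypothesis no_root : forall u, u * s u * s (s u) - u != c.

Let c_neq0 : c != 0.
Proof. by have := no_root 0; rewrite !mul0r subr0 eq_sym. Qed.

Let s_eq0 x : s x = 0 -> x = 0.
Proof. by move/eqP; rewrite fmorph_eq0 => /eqP. Qed.

Let iter_s i : {morph iter i s : x y / x - y}.
Proof. by elim: i => // i IHi x y; rewrite !iterS IHi rmorphB. Qed.

Let TrB x y : Tr (x - y) = Tr x - Tr y.
Proof. by rewrite -sumrB; apply: eq_bigr => i _; apply: iter_s. Qed.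

Let Trs x : Tr (s x) = Tr x.
Proof.
rewrite /Tr; case: d s_order => [|n] sn; first by rewrite !big_ord0.
rewrite big_ord_recr [RHS]big_ord_recl /= -!iterSr sn addrC; congr (_ + _).
by apply: eq_bigr => i _; rewrite -iterSr.
Qed.

(* The equation on z says that z lies in the kernel of the adjoint, for the trace
   form, of P y = u u^s u^(ss) y^(sss) - u y^s - c' y, where c'^s = c. If z <> 0
   then P is not surjective, so P y = 0 for some y <> 0, and (u y^s / y)^s is a
   root. *)
Lemma adjoint_no_root u z :
  s (s c) * s (s (s z)) = s (s u) * (u * s u * z - s (s z)) -> z = 0.
Proof.
move=> Dz; apply/eqP/negPn/negP => nz_z.
have [c' Dc] : exists c', c = s c'.
  have [s1 _ s1K] := injF_bij (fmorph_inj s).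
  by exists (s1 c).
pose P y := u * s u * s (s u) * s (s (s y)) - u * s y - c' * y.
have PB y1 y2 : P (y1 - y2) = P y1 - P y2 by rewrite /P !rmorphB; ring.
have TrP y : Tr (z * P y) = 0.
  pose r := z * u * s u * s (s u) * s (s (s y)).
  have -> : z * P y = r - z * u * s y - z * c' * y by rewrite /P /r; ring.
  (* Invariance of the trace under [s] lets every term be shifted to a multiple of y^(sss); the
     total coefficient then vanishes by the equation on [z]. *)
  rewrite !TrB -[Tr (z * u * s y)]Trs -[Tr (s _)]Trs.
  rewrite -[Tr (z * c' * y)]Trs -[Tr (s (z * c' * _))]Trs.
  rewrite -[Tr (s (s (z * c' * _)))]Trs.
  rewrite -!TrB !rmorphM -Dc.
  have -> : r - s (s z) * s (s u) * s (s (s y))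
      - s (s (s z)) * s (s c) * s (s (s y)) =
     s (s (s y)) * (s (s u) * (u * s u * z - s (s z)) - s (s c) * s (s (s z))).
    by rewrite /r; ring.
  rewrite Dz subrr mulr0 /Tr big1 // => i _.
  by elim: (i : nat) => // j; rewrite iterS => ->; rewrite rmorph0.
have [y nz_y Py0] : exists2 y, y != 0 & P y = 0.
  have [/existsP[y /andP[nz_y /eqP Py]] | ] :=
    boolP [exists y, (y != 0) && (P y == 0)].
    by exists y.
  rewrite negb_exists => /forallP P_inj.
  have /injF_bij[P1 _ P1K] : injective P.
    move=> y1 y2 Py; apply/eqP; have := P_inj (y1 - y2).
    by rewrite PB Py subrr eqxx andbT negbK subr_eq0.
  have [t] := Tr_neq0; have := TrP (P1 (t / z)).
  by rewrite P1K mulrC divfK // => ->; rewrite eqxx.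
have := no_root (s (u * s y / y)); case/eqP.
rewrite Dc -rmorphM -rmorphM -rmorphB; congr (s _).
have nz_sy : s y != 0 by rewrite fmorph_eq0.
have nz_ssy : s (s y) != 0 by rewrite fmorph_eq0.
rewrite !rmorphM !fmorphV.
apply: (mulIf nz_y); apply/eqP; rewrite -subr_eq0; apply/eqP.
rewrite -[RHS]Py0 /P; field.
by rewrite nz_y nz_sy nz_ssy.
Qed.

(** The equations say f(x) = u x for f(x) = (c x2^s, x0^s + x2^s, x1^s). Eliminating x0 and x1
    leaves for x2 the equation of [adjoint_no_root]. *)
Lemma eigenvector_eq0 u x0 x1 x2 :
  c * s x2 = u * x0 -> s x0 + s x2 = u * x1 -> s x1 = u * x2 ->
  [/\ x0 = 0, x1 = 0 & x2 = 0].
Proof.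
move=> e0 e1 e2.
have x20 : x2 = 0.
  apply: (adjoint_no_root (u := u)).
  rewrite -!rmorphM e0 !rmorphM; congr (_ * _).
  have := congr1 s e1; rewrite rmorphD rmorphM e2 => e1'.
  by apply: (addIr (s (s x2))); rewrite e1'; ring.
subst x2; have x10 : x1 = 0 by apply: s_eq0; rewrite e2 mulr0.
by split=> //; apply: s_eq0; move: e1; rewrite rmorph0 addr0 x10 mulr0.
Qed.

(* Here y = f(x) and the remaining equations say f(y) = b y + a x. The cross product
   l = x * y is then, up to the factor - a, mapped to itself by the semilinear map
   given by the cofactors of f, and if l <> 0 then l1 / l0 is a root; if l = 0,
   x is an eigenvector of f. *)
Lemma cyclic_vector x0 x1 x2 y0 y1 y2 a b :
  y0 = c * s x2 -> y1 = s x0 + s x2 -> y2 = s x1 ->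
  c * s y2 = b * y0 + a * x0 -> s y0 + s y2 = b * y1 + a * x1 ->
  s y1 = b * y2 + a * x2 -> [/\ x0 = 0, x1 = 0 & x2 = 0].
Proof.
move=> Dy0 Dy1 Dy2 e0 e1 e2.
pose l0 := x1 * y2 - x2 * y1; pose l1 := x2 * y0 - x0 * y2.
pose l2 := x0 * y1 - x1 * y0.
have El0 : - a * l0 = s l2 - s l0.
  transitivity (y1 * (b * y2 + a * x2) - y2 * (b * y1 + a * x1)).
    by rewrite /l0; ring.
  by rewrite -e1 -e2 /l2 /l0 Dy1 Dy2 !(rmorphB, rmorphM, rmorphD); ring.
have El1 : - a * l1 = c * s l0.
  transitivity (y2 * (b * y0 + a * x0) - y0 * (b * y2 + a * x2)).
    by rewrite /l1; ring.
  by rewrite -e0 -e2 /l0 Dy0 Dy2 !(rmorphB, rmorphM); ring.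
have El2 : - a * l2 = c * s l1.
  transitivity (y0 * (b * y1 + a * x1) - y1 * (b * y0 + a * x0)).
    by rewrite /l2; ring.
  by rewrite -e0 -e1 /l1 Dy0 Dy1 !(rmorphB, rmorphM); ring.
have [l00 l10 l20] : [/\ l0 = 0, l1 = 0 & l2 = 0].
  have [a0 | nz_a] := eqVneq a 0.
    have c_inj x : 0 = c * s x -> x = 0.
      by move/esym/eqP; rewrite mulf_eq0 (negPf c_neq0) => /eqP/s_eq0.
    move: El0 El1 El2; rewrite a0 oppr0 !mul0r => El0 /c_inj l00 /c_inj l10.
    by split=> //; apply: s_eq0; move: El0; rewrite l00 rmorph0 subr0.
  have na : - a != 0 by rewrite oppr_eq0.
  have [l00 | nz_l0] := eqVneq l0 0.
    have l10 : l1 = 0.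
      by apply: (mulfI na); rewrite El1 l00 rmorph0 !mulr0.
    by split=> //; apply: (mulfI na); rewrite El2 l10 rmorph0 !mulr0.
  have := no_root (l1 / l0); case/eqP.
  have nz_sl0 : s l0 != 0 by rewrite fmorph_eq0.
  have nz_ssl0 : s (s l0) != 0 by rewrite fmorph_eq0.
  have nsa : s (- a) != 0 by rewrite fmorph_eq0.
  have nssa : s (s (- a)) != 0 by rewrite fmorph_eq0.
  have Dl1 : l1 = c * s l0 / - a by rewrite -El1 mulrC mulKf.
  have Dl2 : l2 = c * (s c * s (s l0) / s (- a)) / - a.
    by rewrite -!rmorphM -fmorphV -rmorphM -Dl1 -El2 mulrC mulKf.
  move: El0; rewrite Dl1 Dl2 !(rmorphM, fmorphV) /=.
  exact: norm_root_identity.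
have prop (u v w t : K) : w != 0 -> v * u = w * t -> t = v / w * u.
  by move=> nz_w vu; apply: (mulfI nz_w); rewrite -vu; field.
have par01 : x0 * y1 = x1 * y0 by apply/eqP; rewrite -subr_eq0 -/l2 l20.
have par20 : x2 * y0 = x0 * y2 by apply/eqP; rewrite -subr_eq0 -/l1 l10.
have par12 : x1 * y2 = x2 * y1 by apply/eqP; rewrite -subr_eq0 -/l0 l00.
(* Since x and y are parallel, the eigenvalue is the ratio of their coordinates at any place where x
   is nonzero. *)
have [x00 | nz_x0] := eqVneq x0 0; last first.
  apply: (eigenvector_eq0 (u := y0 / x0)); rewrite -?Dy0 -?Dy1 -?Dy2.
  - by apply: prop; rewrite // mulrC.
  - by apply: prop; rewrite // par01 mulrC.
  - by apply: prop; rewrite // -par20 mulrC.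
have [x10 | nz_x1] := eqVneq x1 0; last first.
  apply: (eigenvector_eq0 (u := y1 / x1)); rewrite -?Dy0 -?Dy1 -?Dy2.
  - by apply: prop; rewrite // -par01 mulrC.
  - by apply: prop; rewrite // mulrC.
  - by apply: prop; rewrite // par12 mulrC.
split=> //; move: par20; rewrite x00 mul0r => /eqP; rewrite mulf_eq0.
by case/orP=> /eqP // y00; apply: s_eq0; apply/eqP; move/eqP: Dy0;
  rewrite y00 eq_sym mulf_eq0 (negPf c_neq0).
Qed.

End SkewCubic.

(** * Index 2 subfield, Frobenius and trace *)

Lemma index2_subfield (F : finFieldType) (L : fieldExtType F) :
  ~~ odd (\dim {:L}) -> exists K : {subfield L}, (\dim {:L} = (\dim K).*2)%N.
Proof.
move=> evenL; pose L' := FinSplittingFieldType F L.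
suff: exists K : {subfield L'}, (\dim {:L'} = (\dim K).*2)%N by [].
have evenL' : ~~ odd (\dim {:L'}) by [].
move: L' evenL' => {evenL} {}L evenL.
have [alpha /eqP genL _] := finField_galois_generator (sub1v {:L}).
have oG : #[alpha]%g = \dim {:L}.
  rewrite orderE -genL -galois_dim ?finField_galois ?sub1v //.
  by rewrite dimv1 divn1.
(* The Galois group is cyclic of even order; the fixed field of its subgroup of order 2 has index
   2. *)
pose A := <[(alpha ^+ (\dim {:L})./2)%g]>%g.
have oA : #|A| = 2%N.
  rewrite -orderE orderXdiv oG; last first.
    by rewrite -[X in (_ %| X)%N](even_halfK evenL) -muln2 dvdn_mulr.
  rewrite -{1}(even_halfK evenL) -muln2 mulKn // half_gt0.
  by case: (\dim _) (adim_gt0 {:L}%AS) evenL => [|[|n]].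
exists (fixedField A)%AS.
rewrite (dim_sup_field (subvf (fixedField A)%AS)) /=.
by rewrite -(dim_fixedField A) oA mul2n.
Qed.

Lemma frobenius_morphism (F : finFieldType) (K : fieldExtType F) :
  exists s : {rmorphism K -> K}, forall x, s x = x ^+ #|F|.
Proof.
pose f (x : K) := x ^+ #|F|.
have fA : zmod_morphism f.
  rewrite /f => x y.
  have [p _ pcharFp] := finPcharP F; rewrite (card_pprimeChar pcharFp).
  elim: (logn _ _) => // n IHn; rewrite expnSr !exprM {}IHn.
  by rewrite -(pchar_lalg K) in pcharFp; rewrite -pFrobenius_autE rmorphB.
have fM : monoid_morphism f.
  by rewrite /f; split=> [|x y]; rewrite ?exprMn ?expr1n.
pose faM := GRing.isZmodMorphism.Build _ _ f fA.
pose fmM := GRing.isMonoidMorphism.Build _ _ f fM.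
pose fRM : {rmorphism _ -> _} := HB.pack f faM fmM.
by exists fRM.
Qed.

(** The trace is a polynomial function of degree less than q^d whose coefficient at X is 1, so it
    cannot vanish at all q^d elements. *)
Lemma trace_neq0 (K : finFieldType) (q d : nat) :
  (1 < q)%N -> (0 < d)%N -> #|K| = (q ^ d)%N ->
  exists t : K, \sum_(i < d) t ^+ (q ^ i) != 0.
Proof.
move=> q_gt1 d_gt0 oK.
have [/existsP[t nz_t]|] := boolP [exists t : K, \sum_(i < d) t ^+ (q ^ i) != 0].
  by exists t.
rewrite negb_exists => /forallP tr0.
pose p : {poly K} := \sum_(i < d) 'X^(q ^ i).
have nz_p : p != 0.
  apply: contra_neq (oner_neq0 K) => /(congr1 (fun p : {poly K} => p`_1)).
  rewrite coef0 coef_sum (bigD1 (Ordinal d_gt0)) //= coefXn expn0 eqxx.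
  rewrite big1 ?addr0 // => i i_neq0; rewrite coefXn.
  by rewrite -(expn0 q) eqn_exp2l // eq_sym (negPf (i_neq0 : val i != 0)).
have /(max_poly_roots nz_p) : all (root p) (enum K).
  apply/allP => t _; rewrite rootE horner_sum.
  by under eq_bigr do rewrite hornerXn; have := tr0 t; rewrite negbK.
rewrite enum_uniq -cardE oK => /(_ isT); rewrite ltnNge; case/negP.
apply: leq_trans (size_sum _ _ _) _; apply/bigmax_leqP => i _.
by rewrite size_polyXn ltn_exp2l.
Qed.

(** * Lifting the companion map from K to L *)

Section QuadraticLift.

Variables (F : finFieldType) (L : fieldExtType F) (K : finFieldType).
Variables (iota : {rmorphism K -> L}) (s : {rmorphism K -> K}) (d : nat) (c : K).
Hypothesis s_order : forall x, iter d s x = x.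
Hypothesis Tr_neq0 : exists t, \sum_(i < d) iter i s t != 0.
Hypothesis no_root : forall u, u * s u * s (s u) - u != c.
Hypothesis s_fix : forall x, s x = x -> iota x \in 1%VS.

Variable w : L.
Hypothesis w_free : forall a b, iota a + iota b * w = 0 -> b = 0.
Hypothesis w_span : forall l, exists a b, l = iota a + iota b * w.

(** Write l = a + b w and w^2 = r + t w. Comparing coordinates gives f(x) = a f(y) + r b y and x = b
    f(y) + z y with z = a + t b. Applying f to the second equation yields b^s f(f(y)) = (a - z^s)
    f(y) + r b y. If b <> 0, [cyclic_vector] gives y = 0. If b = 0, then (a - a^s) f(y) = 0 with a^s
    <> a, and f is injective because c <> 0. *)
Lemma quadratic_lift_scattered l x0 x1 x2 y0 y1 y2 : l \notin 1%VS ->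
  iota (c * s x2) + iota x0 * w = l * (iota (c * s y2) + iota y0 * w) ->
  iota (s x0 + s x2) + iota x1 * w = l * (iota (s y0 + s y2) + iota y1 * w) ->
  iota (s x1) + iota x2 * w = l * (iota (s y1) + iota y2 * w) ->
  [/\ x0 = 0, x1 = 0 & x2 = 0].
Proof.
move=> lF.
have [[a [b Dl]] [r [t Dw]]] := (w_span l, w_span (w * w)).
have coef u v u' v' : iota u + iota v * w = l * (iota u' + iota v' * w) ->
    u = a * u' + r * b * v' /\ v = b * u' + (a + t * b) * v'.
  move=> E.
  have {}E : iota (u - (a * u' + r * b * v')) +
      iota (v - (b * u' + (a + t * b) * v')) * w = 0.
    have -> : 0 = iota u + iota v * w - l * (iota u' + iota v' * w) by rewrite E subrr.
    have -> : l * (iota u' + iota v' * w) = iota a * iota u'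
      + (iota a * iota v' + iota b * iota u') * w + iota b * iota v' * (w * w).
      by rewrite Dl; ring.
    by rewrite Dw !(rmorphB, rmorphD, rmorphM); ring.
  have v0 := w_free E; move: E; rewrite v0 rmorph0 mul0r addr0 => /eqP.
  by rewrite fmorph_eq0 subr_eq0 => /eqP; split=> //; apply/eqP; rewrite -subr_eq0 v0.
move=> /coef[e0 e0'] /coef[e1 e1'] /coef[e2 e2'].
have [z Dz] : exists z, z = a + t * b by eexists.
rewrite -Dz in e0' e1' e2'.
suff [y00 y10 y20] : [/\ y0 = 0, y1 = 0 & y2 = 0].
  by rewrite e0' e1' e2' y00 y10 y20 !rmorph0 !(mulr0, addr0).
have [b0 | nz_b] := eqVneq b 0; last first.
  have nz_sb : s b != 0 by rewrite fmorph_eq0.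
  apply: (cyclic_vector s_order Tr_neq0 no_root (erefl _) (erefl _) (erefl _)
     (b := (a - s z) / s b) (a := r * b / s b)).
  - apply: (mulfI nz_sb); transitivity ((a - s z) * (c * s y2) + r * b * y0).
      by rewrite mulrBl addrAC -e0 e2' rmorphD !rmorphM; ring.
    by field.
  - apply: (mulfI nz_sb); transitivity ((a - s z) * (s y0 + s y2) + r * b * y1).
      by rewrite mulrBl addrAC -e1 e0' e2' !rmorphD !rmorphM; ring.
    by field.
  - apply: (mulfI nz_sb); transitivity ((a - s z) * s y1 + r * b * y2).
      by rewrite mulrBl addrAC -e2 e1' !rmorphD !rmorphM; ring.
    by field.
rewrite b0 rmorph0 mul0r addr0 in Dl.
have nz_az : a - s a != 0.
  by rewrite subr_eq0 eq_sym; apply: contra lF => /eqP/s_fix; rewrite -Dl.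
have c_neq0 : c != 0 by have := no_root 0; rewrite !mul0r subr0 eq_sym.
have s_inj0 u : (a - s a) * s u = 0 -> u = 0.
  by move/eqP; rewrite mulf_eq0 (negPf nz_az) /= fmorph_eq0 => /eqP.
have y20 : y2 = 0.
  apply: s_inj0; apply: (mulfI c_neq0); rewrite mulr0.
  transitivity (a * (c * s y2) + r * b * y0 - c * s x2); last by rewrite e0 subrr.
  by rewrite e2' Dz b0 !(rmorphD, rmorphM, rmorph0); ring.
have y10 : y1 = 0.
  apply: s_inj0.
  transitivity (a * s y1 + r * b * y2 - s x1); last by rewrite e2 subrr.
  by rewrite e1' Dz b0 !(rmorphD, rmorphM, rmorph0); ring.
split=> //; apply: s_inj0.
transitivity (a * (s y0 + s y2) + r * b * y1 - (s x0 + s x2)); last by rewrite e1 subrr.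
by rewrite e0' e2' Dz y20 b0 !(rmorphD, rmorphM, rmorph0); ring.
Qed.

End QuadraticLift.

Lemma scattered_map_even (F : finFieldType) (L : fieldExtType F) (d : nat) :
  \dim {:L} = d.*2 -> exists g : 'rV[F]_(3 * d) -> 'rV[L]_3, scattered_map g.
Proof.
move=> dimL; have [K dimK] : exists K : {subfield L}, (\dim {:L} = (\dim K).*2)%N.
  by apply: index2_subfield; rewrite dimL odd_double.
have {dimK} dimK : \dim K = d by apply: double_inj; rewrite -dimK -dimL.
have d_gt0 : (0 < d)%N by rewrite -dimK adim_gt0.
pose K' := finvect_type (subvs_of K).
have [s Ds] := frobenius_morphism K'.
have oK : #|K'| = (#|F| ^ d)%N.
  rewrite -(card_vspacef (Vector.class K')) (card_vspace (fullv : {vspace K'})).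
  by rewrite dimvf /dim /= dimK.
have [|||t nz_t] := @trace_neq0 K' #|F| d => //; first exact: finNzRing_gt1.
have s_iter i x : iter i s x = x ^+ (#|F| ^ i).
  by elim: i => [|i IHi]; rewrite ?expn0 ?expr1 // iterS IHi Ds -exprM -expnSr.
have [c no_root] : exists c : K', forall u : K', u * s u * s (s u) - u != c.
  apply: (@not_inj_not_surj K' (fun u => u * s u * s (s u) - u) 0 1).
    by rewrite eq_sym oner_neq0.
  by rewrite !rmorph1 !mul1r !mul0r !subrr.
pose iota : {rmorphism K' -> L} := vsval.
have s_order x : iter d s x = x by rewrite s_iter -oK expf_card.
have Tr_neq0 : exists t, \sum_(i < d) iter i s t != 0.
  by exists t; under eq_bigr do rewrite s_iter.
have s_fix (x : K') : s x = x -> iota x \in 1%VS.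
  move=> sx; rewrite (Fermat's_little_theorem 1%AS) dimv1 expn1.
  by rewrite -rmorphXn -Ds sx.
have [w wK] : exists w, w \notin K.
  have : ~~ ({:L} <= K)%VS.
    by apply/negP => /dimvS; rewrite dimL dimK leqNgt -addnn -{1}[d]addn0 ltn_add2l d_gt0.
  by case/subvPn => w _; exists w.
have w_free (a b : K') : iota a + iota b * w = 0 -> b = 0.
  move=> abw; apply/eqP/negPn/negP => nz_b; case/negP: wK.
  have nz_ib : iota b != 0 by rewrite fmorph_eq0.
  have -> : w = - (iota a / iota b).
    apply: (mulfI nz_ib); rewrite mulrN mulrCA mulfV // mulr1.
    by apply/eqP; rewrite -addr_eq0 addrC abw.
  by rewrite memvN rpred_div ?subvsP.
have w_span l : exists a b : K', l = iota a + iota b * w.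
  have deg_w : adjoin_degree K w = 2%N.
    have deg_gt1 : (1 < adjoin_degree K w)%N.
      by rewrite ltn_neqAle eq_sym adjoin_deg_eq1 wK.
    apply/eqP; rewrite eqn_leq deg_gt1 andbT.
    by rewrite -(leq_pmul2r d_gt0) -{1}dimK -dim_Fadjoin mul2n -dimL dimvS ?subvf.
  have lKw : l \in <<K; w>>%VS.
    suff -> : <<K; w>>%VS = {:L}%VS by rewrite memvf.
    by apply/eqP; rewrite eqEdim subvf dim_Fadjoin deg_w dimK dimL mul2n /=.
  have /polyOverP Kp := Fadjoin_polyOver K w l.
  exists (vsproj K (Fadjoin_poly K w l)`_0), (vsproj K (Fadjoin_poly K w l)`_1).
  rewrite /iota /= !vsprojK // -[LHS](Fadjoin_poly_eq lKw).
  rewrite (@horner_coef_wide _ 2); last by rewrite -deg_w size_Fadjoin_poly.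
  by rewrite !big_ord_recl big_ord0 /= expr0 mulr1 addr0 expr1.
have dimK' : \dim {:K'} = d by rewrite dimvf /dim /= dimK.
move: (vbasis {:K'}) (vbasisP {:K'}); rewrite dimK' => e /basis_free/freeP free_e.
(* A row of length 3d is cut into three blocks, the [F]-coordinates of a point x of K^3; [coefs] is
   f(x). *)
pose k (r : 'rV[F]_(3 * d)) (j : 'I_3) : K' := \sum_(i < d) vec_mx r j i *: e`_i.
pose coefs (r : 'rV[F]_(3 * d)) : seq K' :=
  [:: c * s (k r 2%:R); s (k r 0) + s (k r 2%:R); s (k r 1)].
pose g (r : 'rV[F]_(3 * d)) : 'rV[L]_3 :=
  \row_j (iota (coefs r)`_j + iota (k r j) * w).
have kD a x y j : k (a *: x + y) j = a *: k x j + k y j.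
  rewrite scaler_sumr -big_split /=; apply: eq_bigr => i _.
  by rewrite !mxE scalerDl scalerA.
have sD a x y : s (a *: x + y) = a *: s x + s y.
  by rewrite rmorphD !Ds exprZn expf_card.
have iotaD a x y : iota (a *: x + y) = a *: iota x + iota y.
  by [].
have coefsD a x y j : (coefs (a *: x + y))`_j = a *: (coefs x)`_j + (coefs y)`_j.
  case: j => [|[|[|j]]] /=; rewrite ?kD ?sD //.
  - by rewrite mulrDr scalerAr.
  - by rewrite scalerDr addrACA.
  - by rewrite !nth_nil scaler0 addr0.
exists g; split=> [a x y | l x y lF gxy].
  apply/rowP => j; rewrite !mxE coefsD kD !iotaD mulrDl mulr_algl scalerDr.
  by rewrite addrACA scalerAl.
have E (j : 'I_3) : iota (coefs x)`_j + iota (k x j) * w =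
    l * (iota (coefs y)`_j + iota (k y j) * w).
  by move/rowP/(_ j): gxy; rewrite !mxE.
have [x0 x1 x2] := quadratic_lift_scattered s_order Tr_neq0 no_root s_fix w_free
  w_span lF (E 0) (E 1) (E 2%:R).
have vx0 : vec_mx x = 0 :> 'M_(3, d).
  apply/matrixP => j i; rewrite [RHS]mxE; apply: free_e i.
  have jP : [\/ j = 0, j = 1 | j = 2%:R].
    by case: j => [[|[|[|//]]] ?]; [constructor 1|constructor 2|constructor 3]; apply: val_inj.
  by case: jP => ->.
by rewrite -[x]vec_mxK vx0 linear0.
Qed.

(** * m = 1 mod 6 *)

Section Greedy.

Variables (M : finFieldType) (E T D : {set M}).
Hypothesis E1 : 1 \in E.
Hypothesis EB : {in E &, forall x y, x - y \in E}.
Hypothesis EM : {in E &, forall x y, x * y \in E}.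
Hypothesis TV : {in T, forall l, l^-1 \in T}.
Hypothesis disjET : forall x, x \in E -> x \notin T.
Hypothesis subD : {in E & T, forall x l, x - l \in D}.

Let E0 : 0 \in E. Proof. by rewrite -(subrr 1) EB. Qed.

Let EV : {in E, forall x, x^-1 \in E}.
Proof.
have EX n x : x \in E -> x ^+ n \in E.
  by move=> Ex; elim: n => [|n IHn]; rewrite ?expr0 ?exprS ?EM.
move=> x Ex; have [-> | nz_x] := eqVneq x 0; first by rewrite invr0.
suff -> : x^-1 = x ^+ (#|M| - 2) by apply: EX.
apply: (mulfI nz_x); apply: (mulfI nz_x); rewrite mulfV // mulr1 -!exprS.
by rewrite -[(_.+2)%N]add2n subnKC ?finNzRing_gt1 // expf_card.
Qed.

(** With [T] standing for L minus F, the [E]-span of [v] is scattered. Concluding on coefficients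
    rather than on sums also makes [v] independent over [E] when [T] is nonempty. *)
Definition scattered_family k (v : 'I_k -> M) :=
  forall (x y : 'I_k -> M) l, (forall i, x i \in E) -> (forall i, y i \in E) ->
    l \in T -> \sum_i x i * v i = l * \sum_i y i * v i ->
    forall i, x i = 0 /\ y i = 0.

(* A relation a u + phi x = l (b u + phi y) with b <> 0 may be scaled to b = 1, and
   then u = - phi y + phi (a y - x) / (a - l); if b = 0, scale to a = 1 and divide
   by l instead. *)
Lemma greedy_step k (v : 'I_k -> M) : (#|E| ^ k * #|E| ^ k * #|D| < #|M|)%N ->
  scattered_family v ->
  exists u, scattered_family (fun i => oapp v u (unlift ord0 i)).
Proof.
move=> ltM ind_v; pose phi (x : 'I_k -> M) := \sum_i x i * v i.
have phiZ a (x : 'I_k -> M) : phi (fun i => a * x i) = a * phi x.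
  by rewrite mulr_sumr; apply: eq_bigr => i _; rewrite mulrA.
have phiB (x y : 'I_k -> M) : phi (fun i => x i - y i) = phi x - phi y.
  by rewrite -sumrB; apply: eq_bigr => i _; rewrite mulrBl.
pose Ek : {set {ffun 'I_k -> M}} := [set x | x \in ffun_on (mem E)].
pose bad := [set phi (p.1.2 : {ffun 'I_k -> M}) / p.2 - phi (p.1.1 : {ffun 'I_k -> M})
  | p in setX (setX Ek Ek) D].
have [u u_good] : exists u, u \notin bad.
  have : (#|bad| < #|M|)%N.
    apply: leq_ltn_trans (leq_imset_card _ _) _.
    by rewrite !cardsX !cardsE !card_ffun_on !card_ord.
  rewrite -cardsT => lt_bad; have : ~~ ([set: M] \subset bad).
    by apply/negP => /subset_leq_card; rewrite leqNgt lt_bad.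
  by case/subsetPn => u _; exists u.
have goodP (y z : 'I_k -> M) t : (forall i, y i \in E) -> (forall i, z i \in E) ->
    t \in D -> u <> phi z / t - phi y.
  move=> Ey Ez Dt Du; case/negP: u_good; apply/imsetP.
  have phi_ffun x : phi (finfun x) = phi x.
    by apply: eq_bigr => i _; rewrite ffunE.
  exists (finfun y, finfun z, t); rewrite /= ?phi_ffun //.
  by rewrite !inE Dt andbT; apply/andP; split; apply/ffun_onP => i; rewrite ffunE.
exists u => x y l Ex Ey Tl; rewrite !big_ord_recl unlift_none /=.
under eq_bigr do rewrite liftK /=.
under [X in _ = _ * (_ + X)]eq_bigr do rewrite liftK /=.
set x0 := x ord0; set y0 := y ord0.
rewrite -/(phi (fun i => x (lift ord0 i))) -/(phi (fun i => y (lift ord0 i))).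
set x' := fun i => x _; set y' := fun i => y _ => xy.
have Ex' i : x' i \in E by apply: Ex.
have Ey' i : y' i \in E by apply: Ey.
have nz_l : l != 0 by apply: contraTneq Tl => ->; apply: disjET.
have y00 : y0 = 0.
  apply/eqP/negPn/negP => nz_y0.
  have Eiy : y0^-1 \in E by apply: EV; apply: Ey.
  have nz_d : x0 / y0 - l != 0.
    by rewrite subr_eq0; apply: contraTneq Tl => <-; rewrite disjET ?EM ?Ex.
  apply: (goodP (fun i => y0^-1 * y' i)
    (fun i => x0 / y0 * (y0^-1 * y' i) - y0^-1 * x' i) (x0 / y0 - l)).
  - by move=> i; rewrite EM.
  - by move=> i; rewrite EB ?EM ?Ex.
  - by rewrite subD ?EM ?Ex.
  rewrite phiB !phiZ; apply: (mulfI nz_d); rewrite mulrBr mulrCA mulfV // mulr1.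
  apply: (mulfI nz_y0).
  have -> : y0 * ((x0 / y0 - l) * u) = (x0 * u + phi x') - phi x' - l * (y0 * u).
    by field.
  by rewrite xy; field.
have x00 : x0 = 0.
  apply/eqP/negPn/negP => nz_x0.
  have Eix : x0^-1 \in E by apply: EV; apply: Ex.
  apply: (goodP (fun i => x0^-1 * x' i) (fun i => 0 - x0^-1 * y' i) (0 - l^-1)).
  - by move=> i; rewrite EM.
  - by move=> i; rewrite EB ?EM.
  - by rewrite subD ?TV.
  rewrite phiB !phiZ; apply: (mulfI nz_x0).
  have -> : x0 * u = (x0 * u + phi x') - phi x' by rewrite addrK.
  rewrite xy y00 mul0r add0r.
  have -> : phi (fun=> 0) = 0 by rewrite /phi big1 // => i _; rewrite mul0r.
  by field; rewrite nz_x0 oppr_eq0 oner_eq0 nz_l.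
move: xy; rewrite x00 y00 !mul0r !add0r => /(ind_v _ _ _ Ex' Ey' Tl) xy0 i.
by case: (unliftP ord0 i) => [j|] ->; [apply: xy0 | split].
Qed.

Lemma greedy n : (forall k, (k < n)%N -> (#|E| ^ k * #|E| ^ k * #|D| < #|M|)%N) ->
  exists v : 'I_n -> M, scattered_family v.
Proof.
elim: n => [|n IHn] ltM; first by exists (fun=> 0) => x y l _ _ _ _ [].
have [|v /greedy_step[|u ind_u]] := IHn; last by exists (fun i => oapp v u (unlift ord0 i)).
  by move=> k ltkn; apply: ltM; apply: ltnW.
exact: ltM.
Qed.

End Greedy.

(** * Adjoining a root of a cubic to L *)

Lemma cubic_no_root (F : finFieldType) :
  exists c : F, forall x, ~~ root ('X^3 - 'X - c%:P) x.
Proof.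
have [||c no_root] := @not_inj_not_surj F (fun u => u ^+ 3 - u) 0 1.
- by rewrite eq_sym oner_neq0.
- by rewrite !expr0n /= expr1n !subrr.
by exists c => x; rewrite rootE !hornerE subr_eq0.
Qed.

Lemma size_cubic (R : nzRingType) (c : R) : size ('X^3 - 'X - c%:P) = 4%N.
Proof.
rewrite -addrA -opprD size_polyDl size_polyXn // size_polyN.
by rewrite size_XaddC.
Qed.

(** The degree of a root over [F] is at most 3 and divides [\dim {:L}], hence is prime to 6; so it
    is 1 and the root lies in [F]. *)
Lemma no_root_ext (F : finFieldType) (L : fieldExtType F) (c : F) :
  coprime (\dim {:L}) 6 -> (forall x : F, ~~ root ('X^3 - 'X - c%:P) x) ->
  forall x : L, ~~ root ('X^3 - 'X - (c%:A)%:P) x.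
Proof.
move=> coL no_root x; apply/negP => rx.
set p := 'X^3 - 'X - (c%:A)%:P in rx.
have Kp : p \is a polyOver 1%VS.
  by rewrite !rpredB ?rpredX ?polyOverX // polyOverC memvZ ?mem1v.
have degx : (adjoin_degree 1%AS x %| \dim {:L})%N.
  by rewrite adjoin_degreeE dimv1 divn1 field_dimS ?subvf.
have : (adjoin_degree 1%AS x <= 3)%N.
  rewrite -ltnS -size_minPoly -(size_cubic (c%:A : L)) dvdp_leq ?minPoly_dvdp //.
  by rewrite -size_poly_eq0 size_cubic.
have deg_co : coprime (adjoin_degree 1%AS x) 6 := coprime_dvdl degx coL.
have : x \notin 1%VS.
  apply/negP => /vlineP[a Dx]; case/negP: (no_root a); move: rx.
  rewrite Dx !rootE !hornerE -!in_algE -rmorphXn -!rmorphB fmorph_eq0.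
  by [].
rewrite -adjoin_deg_eq1; case: (adjoin_degree _ _) deg_co => [|[|[|[|n]]]] //.
Qed.

Section CubicExtension.

Variables (F L M : finFieldType) (iF : {rmorphism F -> L}) (iL : {rmorphism L -> M}).
Variables (c : F) (theta : M) (m : nat) (R : {set L}).
Hypothesis theta_root : theta ^+ 3 - theta - iL (iF c) = 0.
Hypothesis small_root : forall f : {poly L},
  (size f <= 3)%N -> (map_poly iL f).[theta] = 0 -> f = 0.
Hypothesis m_gt0 : (0 < m)%N.
Hypothesis cardM : #|M| = (#|F| ^ (3 * m))%N.
Hypothesis cardR : #|R| = (#|F| ^ m.-1)%N.
Hypothesis R0 : 0 \in R.
Hypothesis R_compl : forall l, exists a, l - iF a \in R.

Let q_gt0 : (0 < #|F|)%N. Proof. exact: ltnW (finNzRing_gt1 F). Qed.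

Let ev (f : {poly F}) : M := (map_poly iL (map_poly iF f)).[theta].

Let evB f g : ev (f - g) = ev f - ev g.
Proof. by rewrite /ev !rmorphB hornerD hornerN. Qed.
Let evD f g : ev (f + g) = ev f + ev g.
Proof. by rewrite /ev !rmorphD hornerD. Qed.
Let evM f g : ev (f * g) = ev f * ev g.
Proof. by rewrite /ev !rmorphM hornerM. Qed.
Let evC a : ev a%:P = iL (iF a).
Proof. by rewrite /ev !map_polyC hornerC. Qed.

Let E : {set M} := [set ev (rVpoly r) | r : 'rV[F]_3].

(** Reduction modulo the cubic: [E], given by polynomials of degree at most 2, is all of F[theta],
    hence closed under products. *)
Let mem_ev f : ev f \in E.
Proof.
set p : {poly F} := 'X^3 - 'X - c%:P.
have ep : ev p = 0.
  rewrite -theta_root !evB evC; congr (_ - _ - _).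
    by rewrite /ev !map_polyXn hornerXn.
  by rewrite /ev !map_polyX hornerX.
have p_neq0 : p != 0 by rewrite -size_poly_eq0 size_cubic.
apply/imsetP; exists (poly_rV (f %% p)) => //.
rewrite poly_rV_K; last by rewrite -ltnS -(size_cubic c) ltn_modp.
have -> : f %% p = f - f %/ p * p by rewrite {2}(divp_eq f p) addrAC subrr add0r.
by rewrite evB evM ep mulr0 subr0.
Qed.

Let memE x : x \in E -> exists f, x = ev f.
Proof. by case/imsetP => r _ ->; eexists. Qed.

Let cardE : (#|E| <= #|F| ^ 3)%N.
Proof. by apply: leq_trans (leq_imset_card _ _) _; rewrite card_mx mul1n. Qed.

Let T : {set M} := [set iL l | l : L & l \notin codom iF].
(** Since F lies in [E], an element of F can be moved from l into x, so l may be taken in the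
    complement [R] of F, and nonzero. This brings the size below q^(m+2). *)
Let D : {set M} := [set p.1 - iL p.2 | p in setX E (R :\ 0)].

Let cardD : (#|D| < #|F| ^ m.+2)%N.
Proof.
apply: leq_ltn_trans (leq_imset_card _ _) _; rewrite cardsX.
have -> : m.+2 = (3 + m.-1)%N by rewrite -{1}(prednK m_gt0).
rewrite expnD -cardR; apply: leq_ltn_trans (leq_mul cardE (leqnn _)) _.
by rewrite ltn_pmul2l ?expn_gt0 ?q_gt0 // [X in (_ < X)%N](cardsD1 0) R0.
Qed.

(** Linear disjointness: f(theta) = l with f over F of degree at most 2 is a relation that
    [small_root] makes trivial, so l is the constant coefficient of f. *)
Let disjET x : x \in E -> x \notin T.
Proof.
move=> /imsetP[r _ ->]; apply/imsetP => -[l]; rewrite inE => lF ev_l.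
have : map_poly iF (rVpoly r) - l%:P = 0.
  apply: small_root; last first.
    rewrite rmorphB hornerD hornerN /= map_polyC hornerC; apply/eqP.
    by rewrite subr_eq0; apply/eqP.
  rewrite (leq_trans (size_polyD _ _)) // size_polyN geq_max.
  by rewrite size_map_poly size_poly (leq_trans (size_polyC_leq1 _)).
move/eqP; rewrite subr_eq0 => /eqP/(congr1 (fun f : {poly L} => f`_0)).
rewrite coefC eqxx coef_map /= => Dl; case/negP: lF.
by rewrite -Dl codom_f.
Qed.

Let subD : {in E & T, forall x l, x - l \in D}.
Proof.
move=> _ _ /memE[f ->] /imsetP[l lF ->]; have [a laR] := R_compl l.
apply/imsetP; exists (ev (f - a%:P), l - iF a); last first.
  by rewrite /= evB evC rmorphB opprB addrA addrNK.
rewrite inE mem_ev !inE laR andbT; apply: contraTneq lF => /eqP.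
by rewrite subr_eq0 inE => /eqP->; rewrite codom_f.
Qed.

Lemma scattered_cubic_extension k : (3 * k = m + 2)%N ->
  exists g : 'rV[F]_(k * 3) -> M,
    (forall a x y, g (a *: x + y) = iL (iF a) * g x + g y) /\
    (forall l x y, l \notin codom iF -> g x = iL l * g y -> x = 0).
Proof.
move=> Dk; have [||||j ltjk|v ind_v] := @greedy M E T D _ _ _ _ disjET subD k.
- by rewrite -(rmorph1 iL) -(rmorph1 iF) -evC mem_ev.
- by move=> _ _ /memE[f ->] /memE[g ->]; rewrite -evB mem_ev.
- by move=> _ _ /memE[f ->] /memE[g ->]; rewrite -evM mem_ev.
- move=> _ /imsetP[l lF ->]; apply/imsetP; exists l^-1; last by rewrite fmorphV.
  move: lF; rewrite !inE; apply: contra => /codomP[a Dl].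
  by apply/codomP; exists a^-1; rewrite fmorphV -Dl invrK.
- rewrite cardM -expnD; apply: leq_ltn_trans
    (leq_mul (_ : _ <= #|F| ^ (3 * (j + j)))%N (leqnn _)) _.
    by rewrite expnM; case: (j + j)%N => // n; rewrite leq_exp2r.
  (* From j <= k - 1 and 3k = m + 2 follows 6j <= 2m - 2. Equality occurs at j = k - 1, so the
     strict inequality comes from the bound on [D]. *)
  have lt_exp : (3 * (j + j) + m.+2 <= 3 * m)%N by lia.
  by apply: leq_trans (leq_pexp2l q_gt0 lt_exp); rewrite expnD ltn_pmul2l ?expn_gt0 ?q_gt0.
pose A (r : 'rV[F]_(k * 3)) (i : 'I_k) : M := ev (rVpoly (row i (vec_mx r))).
have AD a x y i : A (a *: x + y) i = iL (iF a) * A x i + A y i.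
  by rewrite /A !linearP /= -mul_polyC evD evM evC.
exists (fun r => \sum_i A r i * v i); split=> [a x y | l x y lF Axy].
  rewrite mulr_sumr -big_split; apply: eq_bigr => i _.
  by rewrite AD mulrDl mulrA.
have Ax0 i : A x i = 0.
  have [j|j|||] := ind_v (A x) (A y) (iL l) _ _ _ _ i.
  - exact: mem_ev.
  - exact: mem_ev.
  - by apply/imsetP; exists l; rewrite ?inE.
  - exact: Axy.
  - by [].
suff vx0 : vec_mx x = 0 :> 'M_(k, 3) by rewrite -[x]vec_mxK vx0 linear0.
apply/row_matrixP => i; rewrite row0 -[row i _]rVpolyK.
suff -> : rVpoly (row i (vec_mx x)) = 0 by rewrite linear0.
apply/eqP; rewrite -(map_poly_eq0 iF); apply/eqP/small_root; last exact: Ax0.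
by rewrite size_map_poly size_poly.
Qed.

End CubicExtension.

Lemma scattered_map_coprime6 (F : finFieldType) (L : fieldExtType F) k :
  coprime (\dim {:L}) 6 -> (3 * k = \dim {:L} + 2)%N ->
  exists g : 'rV[F]_(k * 3) -> 'rV[L]_3, scattered_map g.
Proof.
move=> coL Dk; have [c /(no_root_ext coL) no_root] := cubic_no_root F.
pose L' := finvect_type L.
have irr : irreducible_poly ('X^3 - 'X - (c%:A)%:P : {poly L'}).
  by apply: cubic_irreducible; rewrite ?size_cubic.
have [M dimM [theta theta_root theta_gen]] := irredp_FAdjoin irr.
rewrite size_cubic /= in dimM; pose M' := finvect_type M.
have theta_deg : adjoin_degree 1%AS theta = 3%N.
  by rewrite adjoin_degreeE dimv1 divn1 /= theta_gen.
have oL : #|L'| = (#|F| ^ \dim {:L})%N.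
  by rewrite -(card_vspacef (Vector.class L')) (card_vspace (fullv : {vspace L'})).
have oM : #|M'| = (#|F| ^ (3 * \dim {:L}))%N.
  rewrite -(card_vspacef (Vector.class M')) (card_vspace (fullv : {vspace M'})).
  by rewrite [X in (_ ^ X)%N]dimM oL -expnM mulnC.
have small_root (f : {poly L'}) : (size f <= 3)%N ->
    (map_poly (in_alg M') f).[theta] = 0 -> f = 0.
  move=> szf f0; apply/eqP; rewrite -(map_poly_eq0 (in_alg M')).
  rewrite -(@root_small_adjoin_poly _ _ 1%AS theta) ?theta_deg ?size_map_poly //.
    exact/rootP.
  by apply/polyOverP => i; rewrite coef_map /= memvZ ?mem1v.
have theta3 : theta ^+ 3 - theta - in_alg M' (in_alg L' c) = 0.
  move/rootP: theta_root; rewrite !rmorphB /= map_polyXn map_polyX map_polyC.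
  by rewrite !hornerE.
pose R : {set L'} := [set l : L' | l \in ((1%VS)^C%VS : {vspace L'})].
have oR : #|R| = (#|F| ^ (\dim {:L}).-1)%N.
  rewrite cardsE (card_vspace ((1%VS)^C%VS : {vspace L'})).
  by rewrite dimv_compl dimv1 subn1.
have R0 : 0 \in R by rewrite inE mem0v.
have R_compl l : exists a, l - in_alg L' a \in R.
  have : l \in (1%VS + (1%VS)^C)%VS by rewrite addv_complf memvf.
  case/memv_addP => _ /vlineP[a ->] [r rC ->]; exists a.
  by rewrite inE addrC addKr.
have [g [gL g_scat]] := @scattered_cubic_extension F L' M' (in_alg L') (in_alg M')
  c theta _ R theta3 small_root (adim_gt0 {:L}%AS) oM oR R0 R_compl k Dk.
(* M has dimension 3 over L; coordinates in an L-basis identify it with L^3. *)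
move: (vbasis {:M}) (vbasisP {:M}); rewrite dimM => e be.
exists (fun x => \row_j coord e j (g x)); split=> [a x y | l x y lF gxy].
  by apply/rowP => j; rewrite !mxE gL linearD mulr_algl linearZ.
apply: (g_scat l x y).
  by apply: contra lF => /codomP[a ->]; rewrite memvZ ?mem1v.
rewrite mulr_algl (coord_basis be (memvf (g x))) [in RHS](coord_basis be (memvf (g y))).
rewrite scaler_sumr; apply: eq_bigr => j _.
by rewrite scalerA; congr (_ *: _); move/rowP/(_ j): gxy; rewrite !mxE.
Qed.

Theorem theorem6p7 (F : finFieldType) (L : fieldExtType F) (m : nat)
    (dimL : \dim {:L} = m) (m_ge4 : (4 <= m)%N)
    (m_neq3 : m <> 3 %[mod 6]) (m_neq5 : m <> 5 %[mod 6]) :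
  exists C : {vspace 'rV[L]_(m + 2)},
    [/\ \dim C = 3%N, nondegenerate_code C & minimal_code C].
Proof.
have m_gt1 : (1 < m)%N by apply: leq_trans m_ge4.
have [odd_m | even_m] := boolP (odd m); last first.
  have Dm : m = m./2.*2 by rewrite even_halfK.
  have [|g scat_g] := @scattered_map_even F L m./2; first by rewrite dimL.
  (* The dimension 3m/2 is at least m + 2 because m >= 4. *)
  by apply: code_of_scattered_map scat_g; lia.
(* Then m is prime to 6 and 3 divides m + 2, as the cubic construction requires. *)
have m_mod6 : (m %% 6 = 1)%N by lia.
have [||g scat_g] := @scattered_map_coprime6 F L (m.+2 %/ 3).
- by rewrite dimL -coprime_modl m_mod6.
- by rewrite dimL; lia.
by apply: code_of_scattered_map scat_g; lia.
Qed.
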